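(* Let $H$ be a real Hilbert space, let $c\in H$ and $r>0$, and put $C=\mathbb{B}(c,r)=\{x\in H:\|x-c\|\le r\}$. Then the metric projection $P_C:H\to C$ has the following differentiability properties. (i) $P_C$ is strictly Fréchet differentiable on the interior $C^o$, and $\nabla P_C(\bar x)=I_H$ for every $\bar x\in C^o$. (ii) $P_C$ is strictly Fréchet differentiable on $H\setminus C$, and for every $\bar x\in H\setminus C$, $$\nabla P_C(\bar x)(u)=\frac{r}{\|\bar x-c\|}\Big(u-\frac{\langle \bar x-c,u\rangle}{\|\bar x-c\|^2}(\bar x-c)\Big)\quad\text{for all }u\in H.$$ (iii) On the boundary $\mathrm{bd}\,C$: (a) $P_C$ is Gâteaux directionally differentiable on $\mathrm{bd}\,C$ (at every point and along every direction $w\in H\setminus\{0\}$), and for every $\bar x\in \mathrm{bd}\,C$ and $w\in H\setminus\{0\}$, $$P_C'(\bar x)(w)=\begin{cases} w-\dfrac{1}{r^2}\langle \bar x-c,w\rangle(\bar x-c) & \text{if } w\in \bar x^{\uparrow}_{(c,r)},\\[2mm] 0 & \text{if } w=\bar x-c,\\[1mm] w & \text{if } w\in \bar x^{\downarrow}_{(c,r)}.\end{cases}$$ (b) $P_C$ is not Fréchet differentiable at any point $\bar x\in\mathrm{bd}\,C$; that is, $\nabla P_C(\bar x)$ does not exist for any $\bar x\in\mathrm{bd}\,C$.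
   Context: $\langle\cdot,\cdot\rangle$ and $\|\cdot\|$ are the inner product and norm of $H$, and $I_H$ is the identity map of $H$. For a nonempty closed convex set $C\subset H$, $P_C(x)$ is the unique point of $C$ nearest to $x$; $P_C$ is regarded as a map $H\to H$ when discussing derivatives. Let $X,Y$ be Banach spaces and $f:X\to Y$. - $f$ is Gâteaux directionally differentiable at $x$ along $w\in X\setminus\{0\}$ if $f'(x)(w):=\lim_{t\downarrow 0}\frac{f(x+tw)-f(x)}{t}$ exists in $Y$. - $f$ is Fréchet differentiable at $\bar x$ if there is a continuous linear map $\nabla f(\bar x):X\to Y$ with $\lim_{h\to0}\frac{\|f(\bar x+h)-f(\bar x)-\nabla f(\bar x)(h)\|}{\|h\|}=0$. - $f$ is strictly Fréchet differentiable at $\bar x$ if moreover $\lim_{(u,v)\to(\bar x,\bar x),\,u\neq v}\frac{\|f(u)-f(v)-\nabla f(\bar x)(u-v)\|}{\|u-v\|}=0$. - Each of these properties holds on a set $A\subset X$ if it holds at every point of $A$. For $x\in\mathbb{B}(c,r)$ define $$x^{\uparrow}_{(c,r)}=\{v\in H\setminus\{0\}:\exists\,\delta>0\text{ such that }\|(x+tv)-c\|\ge r\ \text{for all } t\in(0,\delta)\},$$ $$x^{\downarrow}_{(c,r)}=\{v\in H\setminus\{0\}:\exists\,\delta>0\text{ such that }\|(x+tv)-c\|< r\ \text{for all } t\in(0,\delta)\}.$$ *)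

(* Defs.v *)
From HB Require Import structures.
From mathcomp Require Export all_boot all_order all_algebra.
From mathcomp Require Export all_classical all_reals all_analysis.

Set Implicit Arguments.
Unset Strict Implicit.
Unset Printing Implicit Defensive.

Import Order.TTheory GRing.Theory Num.Theory.
Import numFieldNormedType.Exports.

Local Open Scope classical_set_scope.
Local Open Scope ring_scope.

(* Linearity in the second argument and positive definiteness follow from
   symmetry and from the fact that the norm is the one induced by [inner]. *)
HB.mixin Record CompleteNormedModule_isHilbert (R : realType) H
    of CompleteNormedModule R H := {
  inner : H -> H -> R;
  innerC : forall x y : H, inner x y = inner y x;
  innerDl : forall x y z : H, inner (x + y) z = inner x z + inner y z;
  innerZl : forall (a : R) (x y : H), inner (a *: x) y = a * inner x y;
  inner_normE : forall x : H, inner x x = `|x| ^+ 2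
}.

#[short(type="hilbertType")]
HB.structure Definition Hilbert (R : realType) :=
  {H of CompleteNormedModule R H & CompleteNormedModule_isHilbert R H}.

Definition cball (R : realType) (V : normedModType R) (c : V) (r : R) : set V :=
  [set x | `|x - c| <= r].

Definition boundary (T : topologicalType) (A : set T) : set T :=
  closure A `\` interior A.

Definition nearest_points (R : realType) (V : normedModType R)
    (C : set V) (x : V) : set V :=
  [set y | C y /\ forall z, C z -> `|x - y| <= `|x - z|].

(* [get] picks the element of [nearest_points C x], which is unique when C is a
   nonempty closed convex subset of a Hilbert space. *)
Definition metric_proj (R : realType) (V : normedModType R)
    (C : set V) (x : V) : V :=
  get (nearest_points C x).

Definition strictly_differentiable (R : realType) (V W : normedModType R)
    (f : V -> W) (x : V) : Prop :=
  differentiable f x /\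
  `|f uv.1 - f uv.2 - 'd f x (uv.1 - uv.2)| / `|uv.1 - uv.2|
    @[uv --> within [set uv : V * V | uv.1 != uv.2] (nbhs (x, x))] --> (0 : R).

Definition gateaux_quotient (R : realType) (V W : normedModType R)
    (f : V -> W) (x w : V) (t : R) : W :=
  t^-1 *: (f (x + t *: w) - f x).

Definition gateaux_differentiable (R : realType) (V W : normedModType R)
    (f : V -> W) (x w : V) : Prop :=
  cvg (gateaux_quotient f x w t @[t --> 0^'+]).

Definition gateaux_derivative (R : realType) (V W : normedModType R)
    (f : V -> W) (x w : V) : W :=
  lim (gateaux_quotient f x w t @[t --> 0^'+]).

Definition up_directions (R : realType) (V : normedModType R)
    (c : V) (r : R) (x : V) : set V :=
  [set v | v != 0 /\ exists2 d : R, 0 < d &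
     forall t : R, 0 < t < d -> r <= `|(x + t *: v) - c|].

Definition down_directions (R : realType) (V : normedModType R)
    (c : V) (r : R) (x : V) : set V :=
  [set v | v != 0 /\ exists2 d : R, 0 < d &
     forall t : R, 0 < t < d -> `|(x + t *: v) - c| < r].

(* Main.v *)
From HB Require Import structures.
Require Import Defs.
From mathcomp Require Import ring lra.
Import Order.TTheory GRing.Theory Num.Theory.
Import numFieldNormedType.Exports.

Local Open Scope classical_set_scope.
Local Open Scope ring_scope.

(** Off the ball, and on its sphere, the projection is the radial retraction
    c + r (x - c) / |x - c|. Writing h = u - v, one has
      u/|u| - v/|v| = h/|u| - <p, h> v,
      p = (u + v) / ((|u| + |v|) |u| |v|),
    and p tends to a/|a|^3 when u, v tend to a <> 0. By Cauchy-Schwarz the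
    error of the linear approximation at a is therefore at most K(u, v) |h|
    with K(u, v) -> 0, which is strict differentiability of the retraction at
    every point other than c. At a point x of the sphere, the ray x + t w stays
    outside the open ball when <x - c, w> >= 0 and enters the ball when
    <x - c, w> < 0, so the one-sided derivatives are those of the retraction
    and of the identity respectively. They do not glue to a linear map: along
    x - c and -(x - c) they equal 0 and -(x - c). *)

(** * Inner product calculus and Cauchy-Schwarz *)

Section Inner.
Set Implicit Arguments.
Unset Strict Implicit.
Context (R : realType) (H : hilbertType R).
Implicit Types x y z : H.

Lemma innerDr x y z : inner x (y + z) = inner x y + inner x z.
Proof. by rewrite innerC innerDl ![inner _ x]innerC. Qed.

Lemma innerZr (a : R) x y : inner x (a *: y) = a * inner x y.
Proof. by rewrite innerC innerZl innerC. Qed.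

Lemma innerNl x y : inner (- x) y = - inner x y.
Proof. by rewrite -scaleN1r innerZl mulN1r. Qed.

Lemma innerNr x y : inner x (- y) = - inner x y.
Proof. by rewrite innerC innerNl innerC. Qed.

Lemma normD_sqr x y : `|x + y| ^+ 2 = `|x| ^+ 2 + 2 * inner x y + `|y| ^+ 2.
Proof. by rewrite -!inner_normE !innerDl !innerDr [inner y x]innerC; ring. Qed.

Lemma normB_sqr x y : `|x - y| ^+ 2 = `|x| ^+ 2 - 2 * inner x y + `|y| ^+ 2.
Proof. by rewrite normD_sqr innerNr normrN mulrN. Qed.

(* Expanding |x + y|^2 turns the triangle inequality into Cauchy-Schwarz. *)
Lemma inner_le_norm x y : inner x y <= `|x| * `|y|.
Proof.
have : `|x + y| ^+ 2 <= (`|x| + `|y|) ^+ 2.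
  by rewrite ler_sqr ?nnegrE ?addr_ge0 // ler_normD.
rewrite normD_sqr; nra.
Qed.

Lemma norm_inner_le x y : `|inner x y| <= `|x| * `|y|.
Proof.
rewrite ler_norml inner_le_norm andbT lerNl -innerNl -(normrN x).
exact: inner_le_norm.
Qed.

(** Reduces vector identities to scalar ones, which [ring] and [field] can close. *)
Lemma eq_inner x y : (forall z, inner x z = inner y z) -> x = y.
Proof.
move=> xy; apply/eqP; rewrite -subr_eq0 -normr_eq0 -sqrf_eq0 -inner_normE.
by rewrite innerDl innerNl xy subrr.
Qed.

Lemma inner_continuous x : continuous (inner x).
Proof.
move=> y; apply/cvgrPdist_le => e e0.
(* The added 1 keeps the divisor positive when x = 0. *)
have x0 : 0 < `|x| + 1 by rewrite ltr_wpDl.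
have : \forall t \near y, `|y - t| <= e / (`|x| + 1).
  by apply: cvgr_dist_le; [exact: cvg_id|exact: divr_gt0].
apply: filterS => t yt; rewrite -innerNr -innerDr.
apply: le_trans (norm_inner_le _ _) _.
move: yt; rewrite ler_pdivlMr// mulrC; apply: le_trans.
by rewrite ler_wpM2r// lerDl.
Qed.

End Inner.

(** * Strict and directional derivatives from a local estimate *)

Section StrictDifferentiability.
Set Implicit Arguments.
Unset Strict Implicit.
Context (R : realType) (V W : normedModType R).

(** Setting v = x in the estimate gives the first-order expansion of f at x, so L is the
    differential by uniqueness. Dividing the estimate by |u - v| and squeezing gives the strict
    limit. *)
Lemma strictly_differentiable_bound (f : V -> W) (L : {linear V -> W})
    (k : V * V -> R) (x : V) :
  continuous L -> k uv @[uv --> (x, x)] --> 0 ->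
  (\forall uv \near (x, x),
    `|f uv.1 - f uv.2 - L (uv.1 - uv.2)| <= k uv * `|uv.1 - uv.2|) ->
  strictly_differentiable f x /\ 'd f x = L :> (V -> W).
Proof.
move=> Lc k0 fL.
have fo : f \o shift x = cst (f x) + L +o_ 0 id.
  apply/eqaddoP => _/posnumP[e].
  have ke : \forall uv \near (x, x), k uv <= e%:num.
    by have := cvgr_le _ k0; apply.
  have cx : (h + x, x) @[h --> (0 : V)] --> (x, x).
    apply: cvg_pair => /=; last exact: cvg_cst.
    have : (h + x) @[h --> (0 : V)] --> 0 + x.
      by apply: cvgD; [exact: cvg_id|exact: cvg_cst].
    by rewrite add0r.
  have fLh : \forall h \near (0 : V),
      `|f (h + x) - f x - L h| <= k (h + x, x) * `|h|.
    have : \forall h \near (0 : V),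
      `|f (h + x) - f x - L (h + x - x)| <= k (h + x, x) * `|h + x - x|.
      exact: cx _ fL.
    by apply: filterS => h; rewrite addrK.
  have keh : \forall h \near (0 : V), k (h + x, x) <= e%:num by exact: cx _ ke.
  near=> h.
  rewrite -![(_ + _ : _ -> _) _]/(_ + _) -![(- _ : _ -> _) _]/(- _) opprD addrA.
  apply: (@le_trans _ _ (k (h + x, x) * `|h|)); first by near: h.
  by rewrite ler_wpM2r//; near: h.
have dL : 'd f x = L :> (V -> W) by apply: diff_unique.
split=> //; split; first by apply/diff_locallyP; rewrite dL.
rewrite dL.
apply: (@squeeze_cvgr _ _ _ _ (cst 0) k).
- rewrite near_withinE; move: fL; apply: filterS => -[u v] /= fuv uv.
  by rewrite divr_ge0 //= ler_pdivrMr // normr_gt0 subr_eq0.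
- exact: cvg_cst.
- exact: cvg_within_filter.
Unshelve. all: by end_near. Qed.

(** The derivative along w is a limit over all t <> 0, here restricted to t > 0. *)
Lemma gateaux_quotient_cvg (f : V -> W) (x w : V) : differentiable f x ->
  gateaux_quotient f x w t @[t --> 0^'+] --> 'd f x w.
Proof.
move=> df; rewrite -deriveE//; apply: cvg_dnbhs_at_right.
have -> : gateaux_quotient f x w =
    (fun h => h^-1 *: ((f \o shift x) (h *: w) - f x)).
  by apply/funext => t; rewrite /gateaux_quotient /= [_ *: w + x]addrC.
exact: diff_derivable.
Qed.

End StrictDifferentiability.

(** * Strict differentiability of the radial retraction *)

Section RadialRetraction.
Set Implicit Arguments.
Unset Strict Implicit.
Context (R : realType) (H : hilbertType R).

Definition radial_retraction (c : H) (r : R) (x : H) : H :=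
  c + (r / `|x - c|) *: (x - c).

(** For a <> 0, this is r / |a| times the orthogonal projection onto the complement of the line
    spanned by a. *)
Definition radial_diff (r : R) (a u : H) : H :=
  (r / `|a|) *: (u - (inner a u / `|a| ^+ 2) *: a).

Fact radial_diff_is_linear r a : linear (radial_diff r a).
Proof.
move=> k u v; rewrite /radial_diff innerDr innerZr; apply: eq_inner => z.
rewrite !(innerDl, innerNl, innerZl); ring.
Qed.

HB.instance Definition _ r a :=
  GRing.isLinear.Build R H H _ (radial_diff r a) (radial_diff_is_linear r a).

Lemma radial_diff_continuous r a : continuous (radial_diff r a).
Proof.
move=> u; rewrite /radial_diff.
apply: cvgZ; [exact: cvg_cst|apply: cvgB; first exact: cvg_id].
by apply: cvgZr_tmp; apply: cvgMr_tmp; exact: inner_continuous.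
Qed.

Definition radial_error (r : R) (a u v : H) : R :=
  let p := ((`|u| + `|v|) * `|u| * `|v|)^-1 *: (u + v) in
  let q := (`|a| ^+ 3)^-1 *: a in
  r * (`| `|u|^-1 - `|a|^-1| + `|p - q| * `|v| + `|q| * `|v - a|).

(* With p and q as in [radial_error], the difference on the left is r times
   (1/|u| - 1/|a|) h - <p - q, h> v - <q, h> (v - a), where h = u - v;
   indeed <u + v, h> = |u|^2 - |v|^2 gives <p, h> = 1/|v| - 1/|u|. *)
Lemma radial_error_bound (r : R) (a u v : H) :
  0 <= r -> a != 0 -> u != 0 -> v != 0 ->
  `|(r / `|u|) *: u - (r / `|v|) *: v - radial_diff r a (u - v)|
    <= radial_error r a u v * `|u - v|.
Proof.
move=> r0; rewrite -!normr_gt0 /radial_error => a0 u0 v0.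
set p := _ *: (u + v); set q := _ *: a; set h := u - v.
have ph : inner p h = `|v|^-1 - `|u|^-1.
  rewrite innerZl innerDl !innerDr !innerNr [inner v u]innerC !inner_normE.
  by field; rewrite !lt0r_neq0 ?addr_gt0 //.
have qh : inner q h = inner a h / `|a| ^+ 3 by rewrite innerZl mulrC.
have -> : (r / `|u|) *: u - (r / `|v|) *: v - radial_diff r a h =
   r *: ((`|u|^-1 - `|a|^-1) *: h - inner (p - q) h *: v
         - inner q h *: (v - a)).
  rewrite innerDl innerNl ph qh; apply: eq_inner => z.
  rewrite /radial_diff !(innerDl, innerNl, innerZl) /h !(innerDr, innerNr).
  by field; rewrite !lt0r_neq0.
rewrite normrZ ger0_norm// -mulrA ler_wpM2l//.
apply: le_trans (ler_normB _ _) _; rewrite mulrDl; apply: lerD; last first.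
  by rewrite normrZ mulrAC ler_wpM2r// norm_inner_le.
apply: le_trans (ler_normB _ _) _; rewrite mulrDl normrZ lerD2l.
by rewrite normrZ mulrAC ler_wpM2r// norm_inner_le.
Qed.

(** The error is continuous in (u, v) at (a, a), and vanishes there because p becomes 2a / (2 |a|^3)
    = q. *)
Lemma radial_error_cvg (T : Type) (F : set_system T) (FF : Filter F)
    (r : R) (a : H) (u v : T -> H) :
  a != 0 -> u @ F --> a -> v @ F --> a ->
  radial_error r a (u t) (v t) @[t --> F] --> 0.
Proof.
move=> a0 cu cv; have na0 : `|a| != 0 by rewrite normr_eq0.
have k0 : radial_error r a a a = 0.
  rewrite /radial_error !subrr !normr0 mulr0 addr0 add0r.
  suff -> : ((`|a| + `|a|) * `|a| * `|a|)^-1 *: (a + a) = (`|a| ^+ 3)^-1 *: a.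
    by rewrite subrr normr0 mul0r mulr0.
  rewrite -[a + a]/(a *+ 2) -scaler_nat scalerA; congr (_ *: _).
  by field; rewrite na0 /= -mulr2n mulrn_eq0.
rewrite -k0.
have cnu : `|u t| @[t --> F] --> `|a| by exact: cvg_norm.
have cnv : `|v t| @[t --> F] --> `|a| by exact: cvg_norm.
apply: cvgMl_tmp; apply: cvgD; first apply: cvgD.
- by apply: cvg_norm; apply: cvgB; [exact: cvgV|exact: cvg_cst].
- apply: cvgM => //; apply: cvg_norm; apply: cvgB; last exact: cvg_cst.
  apply: cvgZ; last exact: cvgD.
  apply: cvgV; last by apply: cvgM => //; apply: cvgM => //; exact: cvgD.
  by rewrite !mulf_neq0// -mulr2n mulrn_eq0.
- by apply: cvgMl_tmp; apply: cvg_norm; apply: cvgB => //; exact: cvg_cst.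
Qed.

(** Agreement near x suffices: this serves the projection at exterior points and the retraction
    itself at points of the sphere. *)
Lemma strictly_differentiable_near_radial (r : R) (c x : H)
    (f : H -> H) : 0 <= r -> x != c ->
  (\forall y \near x, f y = radial_retraction c r y) ->
  strictly_differentiable f x /\ 'd f x = radial_diff r (x - c) :> (H -> H).
Proof.
move=> r0 xc fE; have a0 : x - c != 0 by rewrite subr_eq0.
have cu : (uv.1 - c) @[uv --> (x, x)] --> x - c.
  by apply: cvgB; [exact: cvg_fst|exact: cvg_cst].
have cv : (uv.2 - c) @[uv --> (x, x)] --> x - c.
  by apply: cvgB; [exact: cvg_snd|exact: cvg_cst].
pose k uv := radial_error r (x - c) (uv.1 - c) (uv.2 - c).
apply: (@strictly_differentiable_bound _ _ _ _ (radial_diff r (x - c)) k).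
- exact: radial_diff_continuous.
- exact: radial_error_cvg.
have c1 : \forall uv \near (x, x), uv.1 - c != 0 := cvgr_neq0 _ cu a0.
have c2 : \forall uv \near (x, x), uv.2 - c != 0 := cvgr_neq0 _ cv a0.
have f1 : \forall uv \near (x, x), f uv.1 = radial_retraction c r uv.1.
  exact: (@cvg_fst _ _ (nbhs x) (nbhs x) _ _ fE).
have f2 : \forall uv \near (x, x), f uv.2 = radial_retraction c r uv.2.
  exact: (@cvg_snd _ _ (nbhs x) (nbhs x) _ _ fE).
near=> uv.
have -> : f uv.1 = radial_retraction c r uv.1 by near: uv; exact: f1.
have -> : f uv.2 = radial_retraction c r uv.2 by near: uv; exact: f2.
have u0 : uv.1 - c != 0 by near: uv; exact: c1.
have v0 : uv.2 - c != 0 by near: uv; exact: c2.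
rewrite /radial_retraction /k.
have -> : forall y z : H, c + y - (c + z) = y - z.
  by move=> y z; rewrite opprD addrACA subrr add0r.
have -> : uv.1 - uv.2 = (uv.1 - c) - (uv.2 - c) by rewrite opprB subrKA.
exact: radial_error_bound.
Unshelve. all: by end_near. Qed.

End RadialRetraction.

(** * Nearest points in a normed space *)

Section MetricProjection.
Set Implicit Arguments.
Unset Strict Implicit.
Context (R : realType) (V : normedModType R).

Lemma metric_proj_unique (C : set V) (x p : V) :
  nearest_points C x p -> (forall y, nearest_points C x y -> y = p) ->
  metric_proj C x = p.
Proof. by move=> xp; apply; exact: (getI xp). Qed.

Lemma metric_proj_id (C : set V) (x : V) :
  C x -> metric_proj C x = x.
Proof.
move=> Cx; apply: metric_proj_unique.
  by split=> // z _; rewrite subrr normr0.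
move=> y [_ /(_ _ Cx)]; rewrite subrr normr0 normr_le0 subr_eq0.
by move=> /eqP.
Qed.

End MetricProjection.

(** * The projection onto the ball and its one-sided derivatives *)

Section BallProjection.
Set Implicit Arguments.
Unset Strict Implicit.
Context (R : realType) (H : hilbertType R) (c : H) (r : R).
Hypothesis r_gt0 : 0 < r.

(** Let p be the retraction of x. That p is nearest is the triangle inequality through a point z of
    the ball. A competitor y has |y - c| <= r and |x - y| <= |x - c| - r; squaring both and
    combining gives |y - p|^2 <= 0. The sphere is included. *)
Lemma metric_proj_cball_out (x : H) :
  r <= `|x - c| -> metric_proj (cball c r) x = radial_retraction c r x.
Proof.
move=> rx; have a0 : 0 < `|x - c| by exact: lt_le_trans rx.
have pc : radial_retraction c r x - c = (r / `|x - c|) *: (x - c).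
  by rewrite /radial_retraction [c + _]addrC addrK.
have xp : `|x - radial_retraction c r x| = `|x - c| - r.
  have -> : x - radial_retraction c r x = (1 - r / `|x - c|) *: (x - c).
    by rewrite /radial_retraction opprD addrA scalerBl scale1r.
  rewrite normrZ ger0_norm ?subr_ge0 ?ler_pdivrMr ?mul1r//.
  by rewrite mulrBl mul1r divfK ?gt_eqF.
have Cp : cball c r (radial_retraction c r x).
  rewrite /cball /= pc normrZ (ger0_norm (divr_ge0 (ltW r_gt0) (ltW a0))).
  by rewrite divfK ?gt_eqF.
apply: metric_proj_unique; first split=> //.
  move=> z Cz; rewrite xp lerBlDr; apply: le_trans (lerD (lexx _) Cz).
  by rewrite -[x - c](subrKA z) ler_normD.
move=> y [Cy /(_ _ Cp)]; rewrite xp => xy.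
apply/eqP; rewrite -subr_eq0 -normr_eq0 -sqrf_eq0 eq_le sqr_ge0 andbT.
have -> : y - radial_retraction c r x = (y - c) - (r / `|x - c|) *: (x - c).
  by rewrite /radial_retraction opprD addrA.
have {}xy : `|(x - c) - (y - c)| ^+ 2 <= (`|x - c| - r) ^+ 2.
  by rewrite ler_sqr ?nnegrE ?subr_ge0// opprB subrKA.
have Cy2 : `|y - c| ^+ 2 <= r ^+ 2.
  by rewrite ler_sqr ?nnegrE; [exact: Cy| |exact: ltW].
rewrite normB_sqr innerZr innerC normrZ.
rewrite (ger0_norm (divr_ge0 (ltW r_gt0) (ltW a0))) divfK ?gt_eqF//.
move: xy Cy2; rewrite normB_sqr => xy Cy2.
set i := inner _ _ in xy *; set n := `|x - c| in rx a0 xy *.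
set b := `|y - c| ^+ 2 in xy Cy2 *.
have s1 : r / n <= 1 by rewrite ler_pdivrMr ?mul1r.
have s0 : 0 <= r / n by rewrite divr_ge0 ?ltW.
have sn : r / n * n = r by rewrite divfK ?gt_eqF.
(* The goal is at most the sum of these two nonpositive terms; the second one
   is r/n times the inequality [xy]. *)
have : (1 - r / n) * (b - r ^+ 2) <= 0.
  by rewrite mulr_ge0_le0 ?subr_ge0 ?subr_le0.
have : r / n * (b + 2 * r * n - r ^+ 2 - 2 * i) <= 0.
  by rewrite mulr_ge0_le0//; lra.
have : r / n * (2 * r * n) = 2 * r ^+ 2.
  by rewrite mulrC -[_ * n * _]mulrA [n * _]mulrC sn expr2 mulrA.
lra.
Qed.

Lemma boundary_cball (x : H) : boundary (cball c r) x -> `|x - c| = r.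
Proof.
move=> [clx intx]; apply/eqP; rewrite eq_le; apply/andP; split.
  have clC : closed (cball c r).
    have -> : cball c r = (fun x : H => `|x - c|) @^-1` [set t | t <= r] by [].
    apply: closed_comp => [y _|]; last exact: closed_le.
    by apply: cvg_norm; apply: cvgB; [exact: cvg_id|exact: cvg_cst].
  by move: clx; rewrite -(closure_id (cball c r)).1.
rewrite leNgt; apply/negP => xr; apply: intx.
have : \forall y \near x, `|y - c| < r.
  apply: (cvgr_lt `|x - c|) => //.
  by apply: cvg_norm; apply: cvgB; [exact: cvg_id|exact: cvg_cst].
by apply: filterS => y; exact: ltW.
Qed.

Lemma norm_ray_ge (x w : H) (t : R) : `|x - c| = r ->
  0 <= inner (x - c) w -> 0 <= t -> r <= `|x + t *: w - c|.
Proof.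
move=> xr xw t0; rewrite addrAC -ler_sqr ?nnegrE ?(ltW r_gt0)//.
rewrite normD_sqr xr innerZr -addrA lerDl addr_ge0 ?exprn_ge0//.
by rewrite !mulr_ge0.
Qed.

Lemma norm_ray_lt (x w : H) : `|x - c| = r -> inner (x - c) w < 0 ->
  \forall t \near 0^'+, `|x + t *: w - c| < r.
Proof.
move=> xr xw.
(* Since |x - c + t w|^2 - r^2 = t (2 <x - c, w> + t |w|^2), any positive t below -2 <x - c, w> /
   (|w|^2 + 1) works; the 1 secures a positive denominator. *)
have w0 : 0 < `|w| ^+ 2 + 1 by rewrite ltr_wpDl ?exprn_ge0.
have d0 : 0 < - (2 * inner (x - c) w) / (`|w| ^+ 2 + 1).
  by rewrite divr_gt0//; lra.
near=> t.
have t0 : 0 < t by [].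
have : t < - (2 * inner (x - c) w) / (`|w| ^+ 2 + 1).
  by near: t; exact: nbhs_right_lt.
rewrite ltr_pdivlMr// => td.
rewrite addrAC -ltr_sqr ?nnegrE ?(ltW r_gt0)// normD_sqr xr innerZr normrZ exprMn.
rewrite (gtr0_norm t0).
suff : t * (2 * inner (x - c) w + t * `|w| ^+ 2) < 0 by lra.
rewrite pmulr_rlt0//; lra.
Unshelve. all: by end_near. Qed.

(** A negative inner product would put x + t w strictly inside the ball for small t > 0. *)
Lemma up_directions_inner (x w : H) : `|x - c| = r ->
  up_directions c r x w -> 0 <= inner (x - c) w.
Proof.
move=> xr [_ [d d0 up]]; rewrite leNgt; apply/negP => xw.
near (0 : R)^'+ => t.
have := up t; rewrite leNgt => /(_ _)/negP; apply; last first.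
  by near: t; exact: norm_ray_lt.
by apply/andP; split=> //; near: t; exact: nbhs_right_lt.
Unshelve. all: by end_near. Qed.

Lemma down_directions_inner (x w : H) : `|x - c| = r ->
  down_directions c r x w -> inner (x - c) w < 0.
Proof.
move=> xr [_ [d d0 down]]; rewrite ltNge; apply/negP => xw.
have d2 : 0 < d / 2 by rewrite divr_gt0.
have /down : 0 < d / 2 < d by apply/andP; split => //; lra.
by rewrite ltNge (norm_ray_ge xr xw (ltW d2)).
Qed.

Let P := metric_proj (cball c r).

(** The ray stays where the projection equals the retraction, which is differentiable at x, so the
    two quotients agree for t > 0. *)
Lemma gateaux_cball_up (x w : H) : `|x - c| = r -> 0 <= inner (x - c) w ->
  gateaux_quotient P x w t @[t --> 0^'+] -->
    w - (1 / r ^+ 2 * inner (x - c) w) *: (x - c).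
Proof.
move=> xr xw.
have xc : x != c by rewrite -subr_eq0 -normr_gt0 xr.
have [[df _] dE] := @strictly_differentiable_near_radial _ _ r c x
  (radial_retraction c r) (ltW r_gt0) xc (nearW _ (fun=> erefl)).
have := gateaux_quotient_cvg (w := w) df.
rewrite dE /radial_diff xr divff ?gt_eqF// scale1r mul1r mulrC.
apply: cvg_trans; apply: near_eq_cvg; near=> t.
rewrite /gateaux_quotient /P !metric_proj_cball_out ?xr//.
by apply: norm_ray_ge => //; exact: ltW.
Unshelve. all: by end_near. Qed.

Lemma gateaux_cball_down (x w : H) : `|x - c| = r -> inner (x - c) w < 0 ->
  gateaux_quotient P x w t @[t --> 0^'+] --> w.
Proof.
(* Both x and x + t w lie in the ball for small t > 0, so the quotient is exactly w. *)
move=> xr xw; apply: cvg_near_cst; near=> t.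
rewrite /gateaux_quotient /P !metric_proj_id.
- by rewrite addrAC subrr add0r scalerA mulVf ?scale1r.
- by rewrite /cball /= xr.
- by apply: ltW; near: t; exact: norm_ray_lt.
Unshelve. all: by end_near. Qed.

End BallProjection.

(** * Interior, exterior and sphere *)

Theorem theorem3p4 (R : realType) (H : hilbertType R) (c : H) (r : R)
    (r_gt0 : 0 < r) :
  let C : set H := cball c r in
  let P : H -> H := metric_proj C in
  [/\ (* (i) *)
      forall x : H, interior C x ->
        strictly_differentiable P x /\ (forall u : H, 'd P x u = u),
      (* (ii) *)
      forall x : H, ~ C x ->
        strictly_differentiable P x /\
        (forall u : H, 'd P x u =
           (r / `|x - c|) *: (u - (inner (x - c) u / `|x - c| ^+ 2) *: (x - c))),
      (* (iii)(a) *)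
      forall x : H, boundary C x -> forall w : H, w != 0 ->
        [/\ gateaux_differentiable P x w,
            up_directions c r x w ->
              gateaux_derivative P x w =
                w - (1 / r ^+ 2 * inner (x - c) w) *: (x - c),
            w = x - c -> gateaux_derivative P x w = 0 &
            down_directions c r x w -> gateaux_derivative P x w = w] &
      (* (iii)(b) *)
      forall x : H, boundary C x -> ~ differentiable P x].
Proof.
move=> C P; split.
- move=> x Cx.
  (* The projection is the identity near x, so the error factor is 0. *)
  have [|||sd dE] := @strictly_differentiable_bound _ _ _ P idfun (cst 0) x.
  + by move=> y; exact: cvg_id.
  + exact: cvg_cst.
  + have C1 : \forall uv \near (x, x), C uv.1.
      exact: (@cvg_fst _ _ (nbhs x) (nbhs x) _ _ Cx).
    have C2 : \forall uv \near (x, x), C uv.2.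
      exact: (@cvg_snd _ _ (nbhs x) (nbhs x) _ _ Cx).
    near=> uv; rewrite /P !metric_proj_id; last 2 first.
    * by near: uv; exact: C2.
    * by near: uv; exact: C1.
    by rewrite /= subrr normr0 mul0r.
  by split=> // u; rewrite dE.
- move=> x /negP; rewrite -ltNge => rx.
  have xc : x != c by rewrite -subr_eq0 -normr_gt0 (lt_trans r_gt0).
  have [|sd dE] := @strictly_differentiable_near_radial _ _ r c x P
    (ltW r_gt0) xc.
    have : \forall y \near x, r < `|y - c|.
      apply: (cvgr_gt `|x - c|) => //.
      by apply: cvg_norm; apply: cvgB; [exact: cvg_id|exact: cvg_cst].
    by apply: filterS => y ry; rewrite /P metric_proj_cball_out // ltW.
  by split=> // u; rewrite dE.
- move=> x /boundary_cball xr w _; split.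
  + rewrite /gateaux_differentiable; have [xw|xw] := leP 0 (inner (x - c) w).
      by apply/cvg_ex; eexists; exact: gateaux_cball_up.
    by apply/cvg_ex; eexists; exact: gateaux_cball_down.
  + move=> /(up_directions_inner r_gt0 xr) xw.
    by apply: cvg_lim => //; exact: gateaux_cball_up.
  + move=> ->; apply: cvg_lim => //.
    have := @gateaux_cball_up _ _ c r r_gt0 x (x - c) xr.
    (* With w = x - c the coefficient is r^2 / r^2 = 1, so the tangential formula gives 0. *)
    rewrite inner_normE xr mul1r mulVf ?expf_neq0 ?lt0r_neq0//.
    by rewrite scale1r subrr; apply; exact: sqr_ge0.
  + move=> /(down_directions_inner r_gt0 xr) xw.
    by apply: cvg_lim => //; exact: gateaux_cball_down.
- move=> x /boundary_cball xr dP.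
  have a2 : inner (x - c) (x - c) = r ^+ 2 by rewrite inner_normE xr.
  have up : 'd P x (x - c) = 0.
    apply: (cvg_unique _ (gateaux_quotient_cvg (w := x - c) dP)) => //.
    have := @gateaux_cball_up _ _ c r r_gt0 x (x - c) xr.
    rewrite a2 mul1r mulVf ?expf_neq0 ?lt0r_neq0//.
    by rewrite scale1r subrr; apply; exact: sqr_ge0.
  have down : 'd P x (- (x - c)) = - (x - c).
    apply: (cvg_unique _ (gateaux_quotient_cvg (w := - (x - c)) dP)) => //.
    apply: gateaux_cball_down => //.
    by rewrite innerNr a2 oppr_lt0 exprn_gt0.
  (* Linearity turns the value 0 along x - c into 0 along its opposite, forcing x - c = 0 although
     |x - c| = r > 0. *)
  move: down; rewrite linearN up oppr0 => /eqP.
  by rewrite eq_sym oppr_eq0 -normr_eq0 xr gt_eqF.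
Unshelve. all: by end_near. Qed.
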